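(* Let $(\mathfrak g,J,g)$ be a nilpotent almost abelian pseudo-Kähler Lie algebra. Then $b_1(\mathfrak g)\ge3$.
   Context: Lie algebras are real and finite-dimensional. A Lie algebra is almost abelian if it has a codimension-one abelian ideal. A pseudo-Kähler structure on $\mathfrak g$ is a pair $(J,g)$ with $J\in\mathrm{End}(\mathfrak g)$, $J^2=-\mathrm{Id}$, $[X,Y]+J[JX,Y]+J[X,JY]-[JX,JY]=0$ for all $X,Y$; $g$ a nondegenerate symmetric bilinear form of arbitrary signature with $g(JX,JY)=g(X,Y)$; and $\omega=g(J\cdot,\cdot)$ satisfying $\omega([X,Y],Z)+\omega([Y,Z],X)+\omega([Z,X],Y)=0$. $b_1(\mathfrak g)=\dim H^1(\mathfrak g)=\dim\mathfrak g-\dim[\mathfrak g,\mathfrak g]$, where $H^\bullet(\mathfrak g)$ is Chevalley–Eilenberg cohomology with trivial real coefficients.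
   Formalization: The case dim 𝔤 = 2 is excluded: there the claim fails, since abelian ℝ² with its standard Kähler structure is nilpotent, has a codimension-one abelian ideal and has b₁ = 2. *)

(* Defs.v *)
From HB Require Import structures.
From mathcomp Require Import all_boot all_order all_algebra.
From mathcomp Require Import reals.

Set Implicit Arguments.
Unset Strict Implicit.
Unset Printing Implicit Defensive.

Import GRing.Theory.
Local Open Scope ring_scope.

HB.mixin Record Vector_isLieAlgebra (R : fieldType) L of Vector R L := {
  lie : L -> L -> L;
  lie_bilinear_subproof : bilinear_for *:%R *:%R lie;
  liexx : forall x, lie x x = 0;
  lie_jacobi : forall x y z,
    lie x (lie y z) + lie y (lie z x) + lie z (lie x y) = 0
}.

#[short(type="lieAlgType")]
HB.structure Definition LieAlgebra (R : fieldType) :=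
  {L of Vector_isLieAlgebra R L & Vector R L}.

Section LieTheory.
Variables (R : fieldType) (L : lieAlgType R).
Implicit Types (x y z : L) (U V W h : {vspace L}) (a : 'Hom(L, R^o)).

HB.instance Definition _ := bilinear_isBilinear.Build R L L L *:%R *:%R
  (@lie R L) (@lie_bilinear_subproof R L).

HB.instance Definition _ x := GRing.isLinear.Build R L L *:%R
  (@lie R L x) ((@lie_bilinear_subproof R L).2 x).

Definition ad x : 'End(L) := linfun (lie x).

Lemma adE x y : ad x y = lie x y.
Proof. by rewrite /ad lfunE. Qed.

Definition lie_prod U V : {vspace L} :=
  <<[seq lie u v | u <- vbasis U, v <- vbasis V]>>%VS.

Lemma mem_lie_prod U V x y : x \in U -> y \in V -> lie x y \in lie_prod U V.
Proof.
move=> /coord_vbasis-> /coord_vbasis->.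
rewrite linear_sumr; apply: memv_suml => i _.
rewrite linear_sumlz; apply: memv_suml => j _.
rewrite linearZr_LR linearZl_LR /=; apply/memvZ/memvZ/memv_span.
by apply: allpairs_f; apply: mem_nth; rewrite size_tuple.
Qed.

Lemma lie_prod_sub U V W :
  {in U & V, forall x y, lie x y \in W} -> (lie_prod U V <= W)%VS.
Proof.
move=> h; apply/span_subvP => _ /allpairsP[[x y] [/= xU yV ->]].
by apply: h; apply: vbasis_mem.
Qed.

Definition lower_central (n : nat) : {vspace L} :=
  iter n (lie_prod fullv) fullv.

Definition lie_ideal h : Prop := forall x y, y \in h -> lie x y \in h.

Definition lie_abelian h : Prop := {in h &, forall x y, lie x y = 0}.

(* Chevalley-Eilenberg differentials with trivial coefficients in degrees 0
   and 1. The first sends c to x |-> x . c, which vanishes for the trivial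
   action. The second takes values in curried bilinear maps; since linfun
   accepts arbitrary functions, ce_d1E is what pins down its values. *)
Definition ce_d0 : 'Hom(R^o, 'Hom(L, R^o)) := 0.

Definition ce_d1_fun a : 'Hom(L, 'Hom(L, R^o)) :=
  linfun (fun x => - (a \o ad x)%VF).

Definition ce_d1 : 'Hom('Hom(L, R^o), 'Hom(L, 'Hom(L, R^o))) :=
  linfun ce_d1_fun.

Lemma ce_d1_funE a x y : ce_d1_fun a x y = - a (lie x y).
Proof.
have lin : linear (fun x => - (a \o ad x)%VF).
  move=> k u v; apply/lfunP => w.
  rewrite !(opp_lfunE, comp_lfunE, add_lfunE, scale_lfunE, adE).
  by rewrite linearDl /= linearZl_LR /= linearD linearZ opprD scalerN.
pose f := HB.pack_for {linear L -> 'Hom(L, R^o)} (fun x => - (a \o ad x)%VF)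
  (GRing.isLinear.Build _ _ _ _ _ lin).
by rewrite /ce_d1_fun (lfunE f) /= opp_lfunE comp_lfunE adE.
Qed.

Lemma ce_d1E a x y : ce_d1 a x y = - a (lie x y).
Proof.
have lin : linear ce_d1_fun.
  move=> k u v; apply/lfunP => z; apply/lfunP => w.
  by rewrite !(ce_d1_funE, add_lfunE, scale_lfunE) opprD scalerN.
pose f := HB.pack_for {linear 'Hom(L, R^o) -> 'Hom(L, 'Hom(L, R^o))} ce_d1_fun
  (GRing.isLinear.Build _ _ _ _ _ lin).
by rewrite /ce_d1 (lfunE f) /= ce_d1_funE.
Qed.

End LieTheory.

Section LieNotions.
Variables (R : fieldType) (L : lieAlgType R).

Definition lie_nilpotent : Prop := exists n, lower_central L n = 0%VS.

Definition almost_abelian : Prop :=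
  exists h : {vspace L},
    [/\ \dim {:L} = (\dim h).+1, lie_ideal h & lie_abelian h].

Definition betti1 : nat :=
  (\dim (lker (ce_d1 L)) - \dim (limg (ce_d0 L)))%N.

Lemma betti1E :
  betti1 = (\dim {:L} - \dim (lie_prod fullv fullv : {vspace L}))%N.
Proof.
set W := lie_prod fullv fullv.
pose res (a : 'Hom(L, R^o)) : 'Hom(subvs_of W, R^o) :=
  (a \o linfun vsval)%VF.
have resE a u : res a u = a (vsval u) by rewrite comp_lfunE lfunE.
have lin : linear res.
  move=> k a b; apply/lfunP => u.
  by rewrite !(resE, add_lfunE, scale_lfunE).
pose res_lin := HB.pack_for {linear 'Hom(L, R^o) -> 'Hom(subvs_of W, R^o)} res
  (GRing.isLinear.Build _ _ _ _ _ lin).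
have img : limg (linfun res_lin) = fullv.
  apply/vspaceP => b; rewrite memvf; apply/memv_imgP.
  exists (b \o linfun (vsproj W))%VF; first exact: memvf.
  apply/lfunP => u.
  by rewrite lfunE /= resE comp_lfunE lfunE /= vsvalK.
have ker : lker (linfun res_lin) = lker (ce_d1 L).
  apply/vspaceP => a; rewrite !memv_ker lfunE /=.
  apply/eqP/eqP => a0.
    apply/lfunP => x; apply/lfunP => y; rewrite ce_d1E !zero_lfunE.
    have xyW : lie x y \in W by apply: mem_lie_prod; exact: memvf.
    by rewrite -(vsprojK xyW) -resE a0 zero_lfunE oppr0.
  apply/lfunP => u; rewrite resE zero_lfunE; apply/eqP; rewrite -memv_ker.
  apply: (subvP _ _ (subvsP u)); apply: lie_prod_sub => x y _ _.
  rewrite memv_ker -oppr_eq0.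
  by rewrite -ce_d1E a0 !zero_lfunE.
have dimh (V : vectType R) : \dim {: 'Hom(V, R^o)} = \dim {:V}.
  by rewrite !dimvf /dim /= muln1.
have := limg_ker_dim (linfun res_lin) fullv.
rewrite img ker capfv !dimh [X in (_ + X)%N]dimvf => <-.
rewrite /betti1 /ce_d0 lim0g dimv0 subn0.
by rewrite addnK.
Qed.

Definition fundamental_form (J : 'End(L)) (g : {symmetric L}) (x y : L) : R :=
  g (J x) y.

Record pseudoKahler (J : 'End(L)) (g : {symmetric L}) : Prop := PseudoKahler {
  pK_square : forall x, J (J x) = - x;
  pK_integrable : forall x y,
    lie x y + J (lie (J x) y) + J (lie x (J y)) - lie (J x) (J y) = 0;
  pK_nondegenerate : nondegenerate g;
  pK_compatible : forall x y, g (J x) (J y) = g x y;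
  pK_closed : forall x y z,
    let omega := fundamental_form J g in
    omega (lie x y) z + omega (lie y z) x + omega (lie z x) y = 0
}.

End LieNotions.

(* Main.v *)
Require Import Defs.
From mathcomp Require Import all_boot all_order all_algebra.
From mathcomp Require Import reals.

Local Open Scope ring_scope.

(** The bound comes from the integrability of [J].

    Let [h] be an abelian ideal of codimension one.  Since [-1] has no square
    root, [h] is not stable under [J], and there is [e] outside [h] with [J e]
    in [h] ([transversal_with_J_image_in_hyperplane]).  As [h] is abelian, every
    bracket is a value of [ad e] ([lie_prod_sub_limg_ad]), so that
    [b_1 >= dim ker (ad e)] by rank-nullity, and it is enough to find three
    independent vectors in that kernel.  One of them is [e].

    For the other two, consider the complex subspace [h :&: J h], of codimension
    two in [L].  Expanding the integrability condition on the pair [e], [x] with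
    [x] in this subspace, the two terms containing [J e] are brackets inside [h]
    and vanish; what remains says that [ad e] commutes with [J] there
    ([ad_commutes_with_J]).  As [h] is an ideal, [ad e] therefore preserves
    [h :&: J h], and it is complex linear on it.  It is also nilpotent, so if the subspace is not zero,
    that is if [dim L > 2], its kernel there is a nonzero complex space and
    contains an independent pair [v], [J v]. *)

Set Implicit Arguments.
Unset Strict Implicit.
Unset Printing Implicit Defensive.

Import Order.TTheory GRing.Theory Num.Theory.

Section LinearAlgebra.
Variables (K : fieldType) (V : vectType K).
Implicit Types (h U : {vspace V}) (f : 'End(V)).

Lemma hyperplane_decomposition h e : \dim {:V} = (\dim h).+1 -> e \notin h ->
  forall x, exists a, x - a *: e \in h.
Proof.
move=> dimh eNh x.
have/eqP sumT : (h + <[e]>)%VS == fullv.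
  rewrite eqEdim subvf dimh (ltn_leqif (dimv_leqif_sup (addvSl h <[e]>))).
  by rewrite subv_add subvv -memvE.
have : x \in (h + <[e]>)%VS by rewrite sumT memvf.
case/memv_addP=> y yh [_ /vlineP[a ->] ->].
by exists a; rewrite addrK.
Qed.

(** The last nonzero iterate of [f] on [x] is killed by [f]. *)
Lemma nilpotent_kernel_vector U f n x :
  (forall y, y \in U -> f y \in U) -> x \in U -> x != 0 -> iter n f x = 0 ->
  exists v, [/\ v \in U, v != 0 & f v = 0].
Proof.
move=> fU; elim: n x => [|n IHn] x xU x0; first by move/eqP; rewrite (negPf x0).
rewrite iterSr; case: (eqVneq (f x) 0) => [fx0 _|fx0]; first by exists x.
exact: IHn (fU _ xU) fx0.
Qed.

End LinearAlgebra.

Section ComplexStructure.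
Variables (K : fieldType) (V : vectType K) (J : 'End(V)).
Hypothesis JK : forall x, J (J x) = - x.
Implicit Types (h : {vspace V}).

Lemma complex_structure_inj : lker J = 0%VS.
Proof.
apply/eqP/lker0P => x y /(congr1 J); rewrite !JK; exact: oppr_inj.
Qed.

Lemma memv_cap_complex h x : x \in (h :&: J @: h)%VS = (x \in h) && (J x \in h).
Proof.
rewrite memv_cap; congr andb; apply/memv_imgP/idP => [[z zh ->]|Jxh].
  by rewrite JK memvN.
by exists (- J x); rewrite ?memvN // linearN /= JK opprK.
Qed.

(** Two hyperplanes meet in codimension at most two. *)
Lemma hyperplane_cap_complex_neq0 h : \dim {:V} = (\dim h).+1 ->
  (2 < \dim {:V})%N -> (h :&: J @: h)%VS != 0%VS.
Proof.
move=> dimh dimV; rewrite -dimv_eq0 -lt0n.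
have dimJ : \dim (J @: h) = \dim h.
  by apply: limg_dim_eq; rewrite complex_structure_inj capv0.
have := dimv_sum_cap h (J @: h); rewrite dimJ.
have := dimvS (subvf (h + J @: h)%VS).
move: dimV; rewrite dimh => d2 le eq.
rewrite -(ltn_add2l (\dim (h + J @: h))) eq addn0.
apply: leq_ltn_trans le _; rewrite -addn1 ltn_add2l; exact: d2.
Qed.

End ComplexStructure.

Section RealComplexStructure.
Variables (R : realFieldType) (V : vectType R) (J : 'End(V)).
Hypothesis JK : forall x, J (J x) = - x.
Implicit Types (h : {vspace V}).

Let sqrD1_neq0 (a : R) : 1 + a ^+ 2 != 0.
Proof. by rewrite gt_eqF // ltr_pwDl // sqr_ge0. Qed.

(** A relation [x = a J x] would give [(1 + a ^ 2) J x = 0]. *)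
Lemma free_complex_line x : x != 0 -> free [:: x; J x].
Proof.
move=> x0; have Jx0 : J x != 0.
  by apply: contraNneq x0 => Jx0; rewrite -oppr_eq0 -JK Jx0 linear0.
rewrite free_cons seq1_free Jx0 andbT span_seq1; apply/vlineP => -[a xE].
have JxE : J x = - (a *: x) by rewrite [in LHS]xE linearZ /= JK scalerN.
have : (1 + a ^+ 2) *: J x == 0.
  by rewrite scalerDl scale1r {1}JxE expr2 -scalerA -xE addNr.
by rewrite scaler_eq0 (negPf (sqrD1_neq0 a)) (negPf Jx0).
Qed.

(** Were [h] stable under [J], the map induced on the line [V / h] would be a
    scalar of square [-1].  Explicitly, if [J e0 = a e0 + y] with [y] in [h],
    then [e = J y] works, since [J e = - y]. *)
Lemma transversal_with_J_image_in_hyperplane h : \dim {:V} = (\dim h).+1 ->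
  exists2 e, e \notin h & J e \in h.
Proof.
move=> dimh.
have /subvPn[e0 _ e0Nh] : ~~ (fullv <= h)%VS.
  by apply/negP => /dimvS; rewrite dimh ltnn.
have [a yh] := hyperplane_decomposition dimh e0Nh (J e0).
set y := J e0 - a *: e0 in yh.
(* Modulo [h], [J y] is [- (1 + a ^ 2) e0]. *)
have JyE : J y + a *: y = - ((1 + a ^+ 2) *: e0).
  rewrite /y linearB linearZ /= JK scalerBr scalerDl scale1r scalerA -expr2.
  by rewrite addrA subrK opprD.
exists (J y); last by rewrite JK memvN.
apply/negP => Jyh; have := memvD Jyh (memvZ a yh).
by rewrite JyE memvN rpredZeq (negPf (sqrD1_neq0 a)) (negPf e0Nh).
Qed.

End RealComplexStructure.

Section AlmostAbelian.
Variables (R : fieldType) (L : lieAlgType R).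
Implicit Types (h : {vspace L}) (e x y : L).

Lemma iter_ad_lower_central e x n : iter n (ad e) x \in lower_central L n.
Proof.
elim: n => [|n IHn]; first exact: memvf.
by rewrite iterS adE; apply: mem_lie_prod; rewrite ?memvf.
Qed.

Lemma lie_anti x y : lie x y = - lie y x.
Proof.
apply/eqP; rewrite -addr_eq0; have := liexx (x + y).
by rewrite linearDl /= !linearDr /= !liexx add0r addr0 => ->.
Qed.

(** For [x = a e + x'] and [y = b e + y'] with [x'], [y'] in [h], the bracket
    [x, y] is [ad e (a y' - b x')], because [x'] and [y'] commute. *)
Lemma lie_prod_sub_limg_ad h e :
  \dim {:L} = (\dim h).+1 -> lie_abelian h -> e \notin h ->
  (lie_prod fullv fullv <= limg (ad e))%VS.
Proof.
move=> dimh abh eNh; apply: lie_prod_sub => x y _ _.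
have [a xh] := hyperplane_decomposition dimh eNh x.
have [b yh] := hyperplane_decomposition dimh eNh y.
move: (x - _) (y - _) xh yh (subrK (a *: e) x) (subrK (b *: e) y).
move=> x' y' x'h y'h <- <-.
rewrite linearDl /= !linearDr /= abh // add0r linearZr_LR !linearZl_LR /=.
rewrite linearZr_LR /= liexx !scaler0 addr0 (lie_anti x').
rewrite -!adE scalerN -scaleNr -!linearZ -linearD /=; exact/memv_img/memvf.
Qed.

Lemma betti1_ge_dim_lker_ad h e :
  \dim {:L} = (\dim h).+1 -> lie_abelian h -> e \notin h ->
  (\dim (lker (ad e)) <= betti1 L)%N.
Proof.
move=> dimh abh eNh; rewrite betti1E.
rewrite -(limg_ker_dim (ad e) fullv) capfv leq_subRL.
  by rewrite addnC leq_add2l dimvS // (lie_prod_sub_limg_ad dimh).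
by apply: leq_trans (dimvS (lie_prod_sub_limg_ad dimh abh eNh)) (leq_addl _ _).
Qed.

Variable J : 'End(L).
Hypothesis JK : forall x, J (J x) = - x.
Hypothesis integrableJ : forall x y,
  lie x y + J (lie (J x) y) + J (lie x (J y)) - lie (J x) (J y) = 0.

(** Both [J x] and [x] commute with [J e], so the integrability condition on
    [e], [x] reduces to [[e, x] + J [e, J x] = 0]. *)
Lemma ad_commutes_with_J h e x : lie_abelian h -> J e \in h ->
  x \in h -> J x \in h -> ad e (J x) = J (ad e x).
Proof.
move=> abh Jeh xh Jxh; have := integrableJ e x.
rewrite !(abh (J e)) // linear0 addr0 subr0 -!adE => /eqP.
rewrite addr_eq0 => /eqP ->; by rewrite linearN /= JK opprK.
Qed.

Lemma ad_stable_cap_complex h e x : lie_ideal h -> lie_abelian h ->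
  J e \in h -> x \in (h :&: J @: h)%VS -> ad e x \in (h :&: J @: h)%VS.
Proof.
move=> idh abh Jeh; rewrite !memv_cap_complex // => /andP[xh Jxh].
by rewrite -(ad_commutes_with_J abh) // !adE !idh.
Qed.

End AlmostAbelian.

Lemma nilpotent_almost_abelian_complex_betti1 (R : realFieldType)
    (L : lieAlgType R) (J : 'End(L)) :
  lie_nilpotent L -> almost_abelian L ->
  (forall x, J (J x) = - x) ->
  (forall x y,
     lie x y + J (lie (J x) y) + J (lie x (J y)) - lie (J x) (J y) = 0) ->
  (2 < \dim {:L})%N -> (3 <= betti1 L)%N.
Proof.
move=> [n nilL] [h [dimh idh abh]] JK intJ dimL.
have [e eNh Jeh] := transversal_with_J_image_in_hyperplane JK dimh.
have := hyperplane_cap_complex_neq0 JK dimh dimL.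
set U := (h :&: J @: h)%VS; rewrite -vpick0 => u0.
have nil_u : iter n (ad e) (vpick U) = 0.
  by apply/eqP; rewrite -memv0 -nilL iter_ad_lower_central.
have adU y : y \in U -> ad e y \in U by apply: ad_stable_cap_complex.
have [v [vU v0 adv]] := nilpotent_kernel_vector adU (memv_pick U) u0 nil_u.
move: vU; rewrite /U memv_cap_complex // => /andP[vh Jvh].
apply: leq_trans (betti1_ge_dim_lker_ad dimh abh eNh).
have : free [:: e; v; J v].
  rewrite free_cons free_complex_line // andbT; apply: contra eNh.
  by apply/subvP/span_subvP => y; rewrite !inE => /pred2P[] ->.
rewrite /free => /eqP /= <-; apply/dimvS/span_subvP => y.
rewrite !inE memv_ker => /or3P[] /eqP->; first by rewrite adE liexx.
  by rewrite adv.
by rewrite (ad_commutes_with_J JK intJ abh) // adv linear0.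
Qed.

Theorem proposition1p6 (R : realType) (L : lieAlgType R)
    (J : 'End(L)) (g : {symmetric L}) :
  lie_nilpotent L -> almost_abelian L -> pseudoKahler J g ->
  \dim {:L} <> 2%N ->
  (3 <= betti1 L)%N.
Proof.
move=> nilL aabL [JK intJ _ _ _] dimL2.
apply: (nilpotent_almost_abelian_complex_betti1 nilL aabL JK intJ).
have [h [dimh _ _]] := aabL.
have [e eNh Jeh] := transversal_with_J_image_in_hyperplane JK dimh.
(* The dimension is not [1]: [J e] is a nonzero vector of [h]. *)
have h0 : (0 < \dim h)%N.
  rewrite lt0n dimv_eq0; apply: contraNneq eNh => h0.
  move: Jeh; rewrite h0 !memv0 => /eqP Je0.
  by rewrite -oppr_eq0 -JK Je0 linear0.
by move/eqP: dimL2; rewrite dimh eqSS; case: (\dim h) h0 => [|[|k]].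
Qed.
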